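(* For $N\ge1$ start the one-dimensional nearest-neighbor symmetric simple exclusion process from the deterministic configuration $\xi^{\gamma_1,N}(x)=1$ for $|x|\le N$ and $\xi^{\gamma_1,N}(x)=0$ otherwise, and fix $T>0$. There is $c_1=c_1(T)>0$ such that for all $a\ge0$: $$\limsup_{N\to\infty}\frac1N\log P\big(|J_{-1,0}(N^2T)|/N\ge a\big)\le\begin{cases}-c_1a^2,&0\le a\le1,\\-\infty,&a>1,\end{cases}$$ $$\limsup_{N\to\infty}\frac1N\log P\big(|X_{N^2T}|/N\ge a\big)\le -c_1a^2.$$
   Context: The process $\eta_t$ on $\{0,1\}^{\mathbb Z}$ has generator $(L\phi)(\eta)=\frac12\sum_x[\eta(x)(1-\eta(x+1))+\eta(x+1)(1-\eta(x))](\phi(\eta^{x,x+1})-\phi(\eta))$, where $\eta^{x,x+1}$ exchanges the values at $x$ and $x+1$. $J_{-1,0}(t)$ is the number of jumps from $-1$ to $0$ minus the number of jumps from $0$ to $-1$ during $[0,t]$. $X_t$ is the position at time $t$ of the tagged particle initially at the origin. *)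

(* Defs.v *)
From Stdlib Require Import Reals Lra List ZArith ClassicalEpsilon.
Import ListNotations.
Open Scope R_scope.

(* Finite-particle SSEP started from xi^{gamma_1,N} = 1_{[-N,N]}.
   Particles are labelled 0..2N (label i starts at i-N); exclusion preserves
   their order, so labelled dynamics = exchange dynamics, and label N is the
   tagged particle initially at the origin.  The state also carries the
   current J_{-1,0} (net number of jumps -1 -> 0). *)
Record state := mkState { pos : list Z; flux : Z }.

Definition init_state (N : nat) : state :=
  mkState (map (fun i => (Z.of_nat i - Z.of_nat N)%Z) (seq 0 (2 * N + 1))) 0%Z.

Definition move (s : state) (i : nat) (d : Z) : state :=
  let x := nth i (pos s) 0%Z in
  let y := (x + d)%Z in
  if existsb (Z.eqb y) (pos s) then s
  else mkState (firstn i (pos s) ++ y :: skipn (S i) (pos s))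
         (flux s
          + (if andb (Z.eqb x (-1)) (Z.eqb d 1) then 1 else 0)
          - (if andb (Z.eqb x 0) (Z.eqb d (-1)) then 1 else 0))%Z.

(* One step of the uniformized chain (total attempt rate M = number of
   particles; each particle tries each direction at rate 1/2). *)
Definition step_dist (M : nat) (mu : list (R * state)) : list (R * state) :=
  flat_map (fun ws =>
    flat_map (fun i => [(fst ws / (2 * INR M), move (snd ws) i 1%Z);
                        (fst ws / (2 * INR M), move (snd ws) i (-1)%Z)])
             (seq 0 M)) mu.

Definition nparts (N : nat) : nat := (2 * N + 1)%nat.

Definition dist_k (N k : nat) : list (R * state) :=
  Nat.iter k (step_dist (nparts N)) [(1, init_state N)].

Definition prob_list (mu : list (R * state)) (A : state -> Prop) : R :=
  fold_right (fun ws acc =>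
    (if excluded_middle_informative (A (snd ws)) then fst ws else 0) + acc) 0 mu.

(* P(eta_t in A) for the continuous-time process (uniformization):
   sum_k e^{-Mt} (Mt)^k / k! * P(embedded chain after k steps in A). *)
Definition prob_at (N : nat) (t : R) (A : state -> Prop) : R :=
  let lt := INR (nparts N) * t in
  epsilon (inhabits 0) (fun p =>
    infinite_sum (fun k => exp (- lt) * lt ^ k / INR (fact k)
                           * prob_list (dist_k N k) A) p).

Definition J (s : state) : Z := flux s.
Definition tagged (N : nat) (s : state) : Z := nth N (pos s) 0%Z.

(* Main.v *)
From Stdlib Require Import Reals ZArith Lra Lia List Permutation ClassicalEpsilon.
Require Import Defs.
Import ListNotations.
Open Scope R_scope.

(** Both events force the number of particles in a half line [{s x >= m}] to exceed
    its mean.  By AM-GM the two blocked jumps of an adjacent pair only help, so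
    [exp (sum_i h_k (x_i))] has one-step growth at most that of free particles, and is
    a supermartingale (k counting steps to go) as soon as [h_{k+1}] dominates [h_k] plus
    its nonlinear drift.  With [phi_k] the free heat evolution of the indicator of the
    half line, [h_k = l phi_k - 6 l^2 phi_k^2] works for small [l] and gives a Gaussian
    bound around the mean number of free particles, with variance of order [N].
    For the current (m = 0) that mean is at most [N + 1] by symmetry; for [m <= N]
    it is smaller by at least a constant (depending on [T]) times [m], which gives
    the tagged-particle bound for bounded [a].  For large [a] one uses
    [h_k = ln (1 + v_k)] with [v_k] an exponential in space.  The random
    number of steps is Poisson, and exceeds four times its mean only with
    probability exponentially small in [N^3]. *)

(** * Finite sums over lists *)

Definition sumR {A : Type} (f : A -> R) (l : list A) : R :=
  fold_right (fun x acc => f x + acc) 0 l.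

Lemma sumR_ext_in {A : Type} (f g : A -> R) (l : list A) :
  (forall x, In x l -> f x = g x) -> sumR f l = sumR g l.
Proof.
  induction l as [|a l IH]; intros H; simpl; [reflexivity|].
  f_equal; [apply H; now left|]. apply IH; intros x Hx; apply H; now right.
Qed.

Lemma sumR_le {A : Type} (f g : A -> R) (l : list A) :
  (forall x, In x l -> f x <= g x) -> sumR f l <= sumR g l.
Proof.
  induction l as [|a l IH]; intros H; simpl; [lra|].
  apply Rplus_le_compat; [apply H; now left|]. apply IH; intros x Hx; apply H; now right.
Qed.

Lemma sumR_plus {A : Type} (f g : A -> R) (l : list A) :
  sumR (fun x => f x + g x) l = sumR f l + sumR g l.
Proof. induction l as [|a l IH]; simpl; [lra|]. rewrite IH. lra. Qed.

Lemma sumR_scal {A : Type} (c : R) (f : A -> R) (l : list A) :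
  sumR (fun x => c * f x) l = c * sumR f l.
Proof. induction l as [|a l IH]; simpl; [lra|]. rewrite IH. lra. Qed.

Lemma sumR_const {A : Type} (c : R) (l : list A) :
  sumR (fun _ => c) l = INR (length l) * c.
Proof.
  induction l as [|a l IH]; [simpl; lra|].
  change (length (a :: l)) with (S (length l)). rewrite S_INR. simpl. rewrite IH. lra.
Qed.

Lemma sumR_app {A : Type} (f : A -> R) (l l' : list A) :
  sumR f (l ++ l') = sumR f l + sumR f l'.
Proof. induction l as [|a l IH]; simpl; [lra|]. rewrite IH. lra. Qed.

Lemma sumR_map {A B : Type} (f : B -> R) (g : A -> B) (l : list A) :
  sumR f (map g l) = sumR (fun x => f (g x)) l.
Proof. induction l as [|a l IH]; simpl; [lra|]. rewrite IH. lra. Qed.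

Lemma sumR_flat_map {A B : Type} (f : B -> R) (g : A -> list B) (l : list A) :
  sumR f (flat_map g l) = sumR (fun x => sumR f (g x)) l.
Proof. induction l as [|a l IH]; simpl; [lra|]. rewrite sumR_app, IH. lra. Qed.

Lemma sumR_swap {A B : Type} (f : A -> B -> R) (l : list A) (l' : list B) :
  sumR (fun x => sumR (f x) l') l = sumR (fun y => sumR (fun x => f x y) l) l'.
Proof.
  induction l as [|a l IH]; simpl.
  - rewrite (sumR_const 0). lra.
  - rewrite IH, sumR_plus. reflexivity.
Qed.

Lemma sumR_perm {A : Type} (f : A -> R) (l l' : list A) :
  Permutation l l' -> sumR f l = sumR f l'.
Proof. induction 1; simpl; lra. Qed.

Lemma sumR_nth {A : Type} (f : A -> R) (l : list A) (d : A) :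
  sumR (fun i => f (nth i l d)) (seq 0 (length l)) = sumR f l.
Proof.
  induction l as [|a l IH]; simpl; [reflexivity|].
  rewrite <- IH, <- seq_shift, sumR_map. reflexivity.
Qed.

Definition set_nth {A : Type} (i : nat) (y : A) (l : list A) : list A :=
  firstn i l ++ y :: skipn (S i) l.

Lemma sumR_set_nth {A : Type} (f : A -> R) (l : list A) (i : nat) (y d : A) :
  (i < length l)%nat ->
  sumR f (set_nth i y l) = sumR f l - f (nth i l d) + f y.
Proof.
  unfold set_nth. revert i; induction l as [|a l IH]; intros [|i] Hi; simpl in *; try lia.
  - lra.
  - rewrite IH by lia. lra.
Qed.

Lemma nth_set_nth {A : Type} (l : list A) (i j : nat) (y d : A) :
  (i < length l)%nat -> nth j (set_nth i y l) d = if Nat.eqb j i then y else nth j l d.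
Proof.
  unfold set_nth. revert i j; induction l as [|a l IH]; intros [|i] [|j] Hi; simpl in *; try lia;
    try reflexivity.
  apply IH; lia.
Qed.

Lemma length_set_nth {A : Type} (l : list A) (i : nat) (y : A) :
  (i < length l)%nat -> length (set_nth i y l) = length l.
Proof.
  unfold set_nth. revert i; induction l as [|a l IH]; intros [|i] Hi; simpl in *; try lia.
  rewrite IH; lia.
Qed.

(** * One-step growth of exponential functionals under exclusion *)

(** Rewrites an occupation test as a sum over a second particle, so that blocked jumps become a sum
    over ordered pairs. *)
Lemma sumR_occupied (l : list Z) (z : Z) (c : Z -> R) :
  NoDup l ->
  sumR (fun y => if Z.eqb z y then c y else 0) l = if existsb (Z.eqb z) l then c z else 0.
Proof.
  induction 1 as [|a l Ha Hl IH]; simpl; [reflexivity|].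
  rewrite IH. destruct (Z.eqb_spec z a) as [->|Hn]; simpl; [|lra].
  replace (existsb (Z.eqb a) l) with false; [lra|].
  symmetry; apply Bool.not_true_iff_false; intros E.
  apply existsb_exists in E as (x & Hx & E). apply Z.eqb_eq in E; subst; auto.
Qed.

(* For a pair of adjacent particles x, y both blocked jumps together
   cost e^(h y - h x) + e^(h x - h y) - 2 >= 0. *)
Lemma blocked_jumps_nonpos (l : list Z) (h : Z -> R) :
  NoDup l ->
  sumR (fun x => (if existsb (Z.eqb (x + 1)) l then 1 - exp (h (x + 1)%Z - h x) else 0)
               + (if existsb (Z.eqb (x + -1)) l then 1 - exp (h (x + -1)%Z - h x) else 0)) l <= 0.
Proof.
  intros Hl.
  rewrite sumR_plus.
  rewrite (sumR_ext_in (fun x => if existsb (Z.eqb (x + 1)) l then _ else 0)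
    (fun x => sumR (fun y => if Z.eqb (x + 1) y then 1 - exp (h y - h x) else 0) l))
    by (intros x _; now rewrite sumR_occupied).
  rewrite (sumR_ext_in (fun x => if existsb (Z.eqb (x + -1)) l then _ else 0)
    (fun x => sumR (fun y => if Z.eqb (x + -1) y then 1 - exp (h y - h x) else 0) l))
    by (intros x _; now rewrite sumR_occupied).
  rewrite (sumR_swap (fun x y => if Z.eqb (x + -1) y then 1 - exp (h y - h x) else 0)).
  rewrite <- sumR_plus.
  apply Rle_trans with (sumR (fun _ => 0) l); [|rewrite sumR_const; lra].
  apply sumR_le; intros x _. rewrite <- sumR_plus.
  apply Rle_trans with (sumR (fun _ => 0) l); [|rewrite sumR_const; lra].
  apply sumR_le; intros y _.
  destruct (Z.eqb_spec (x + 1) y); destruct (Z.eqb_spec (y + -1) x); try lia; try lra.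
  pose proof (exp_ineq1_le (h y - h x)). pose proof (exp_ineq1_le (h x - h y)). lra.
Qed.

Definition wt (h : Z -> R) (s : state) : R := exp (sumR h (pos s)).

Lemma wt_move (h : Z -> R) (s : state) (i : nat) (d : Z) :
  (i < length (pos s))%nat ->
  let x := nth i (pos s) 0%Z in
  wt h (move s i d) = wt h s * (exp (h (x + d)%Z - h x)
    + (if existsb (Z.eqb (x + d)) (pos s) then 1 - exp (h (x + d)%Z - h x) else 0)).
Proof.
  intros Hi x. unfold move, wt. fold x. destruct existsb; simpl.
  - ring.
  - change (firstn i (pos s) ++ (x + d)%Z :: match pos s with [] => [] | _ :: l => skipn i l end)
      with (set_nth i (x + d)%Z (pos s)).
    rewrite (sumR_set_nth _ _ _ _ 0%Z Hi). fold x.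
    rewrite Rplus_0_r, <- exp_plus. f_equal; ring.
Qed.

(** The discrete Laplacian of [exp h] divided by [exp h]. *)
Definition gen (h : Z -> R) (x : Z) : R :=
  exp (h (x + 1)%Z - h x) + exp (h (x + -1)%Z - h x) - 2.

(** Summing the jump factors over particles leaves the free drift [S] plus the blocked corrections,
    whose total is nonpositive. Then [1 + S / (2 M) <= exp (S / (2 M))] returns the drift to the
    exponent, particle by particle. *)
Lemma wt_one_step (h : Z -> R) (s : state) (M : nat) :
  NoDup (pos s) -> length (pos s) = M -> (0 < M)%nat ->
  sumR (fun i => wt h (move s i 1) + wt h (move s i (-1))) (seq 0 M) / (2 * INR M)
  <= wt (fun x => h x + gen h x / (2 * INR M)) s.
Proof.
  intros Hn HM Hpos. assert (0 < INR M) by now apply lt_0_INR.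
  set (l := pos s) in *.
  set (G := fun x : Z => (gen h x + 2) +
    ((if existsb (Z.eqb (x + 1)) l then 1 - exp (h (x + 1)%Z - h x) else 0)
     + (if existsb (Z.eqb (x + -1)) l then 1 - exp (h (x + -1)%Z - h x) else 0))).
  rewrite (sumR_ext_in _ (fun i => wt h s * G (nth i l 0%Z))).
  2:{ intros i Hi. apply in_seq in Hi. rewrite !wt_move by (fold l; lia).
      unfold G, gen, l. ring. }
  rewrite sumR_scal, <- HM, (sumR_nth G l 0%Z), HM.
  unfold G. rewrite sumR_plus, sumR_plus, sumR_const, HM.
  pose proof (blocked_jumps_nonpos l h Hn) as HB.
  set (B := sumR _ l) in HB |- *. set (S := sumR (gen h) l).
  unfold wt. fold l. rewrite sumR_plus, exp_plus.
  rewrite (sumR_ext_in (fun x => gen h x / (2 * INR M)) (fun x => / (2 * INR M) * gen h x))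
    by (intros; field; lra).
  rewrite sumR_scal. fold S.
  unfold Rdiv. rewrite Rmult_assoc. apply Rmult_le_compat_l; [left; apply exp_pos|].
  eapply Rle_trans; [|apply exp_ineq1_le].
  replace (1 + / (2 * INR M) * S) with ((S + INR M * 2) * / (2 * INR M)) by (field; lra).
  apply Rmult_le_compat_r; [left; apply Rinv_0_lt_compat; lra|lra].
Qed.

(** * Invariants of reachable configurations *)

Definition increasing (l : list Z) : Prop :=
  forall i j, (i < j < length l)%nat -> (nth i l 0 < nth j l 0)%Z.

Lemma increasing_NoDup (l : list Z) : increasing l -> NoDup l.
Proof.
  intros H. apply (NoDup_nth l 0%Z). intros i j Hi Hj E.
  destruct (Nat.lt_trichotomy i j) as [L|[L|L]]; auto.
  - specialize (H i j ltac:(lia)); lia.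
  - specialize (H j i ltac:(lia)); lia.
Qed.

(** The sign [s = -1] gives the mirror half line [x <= -m], so one argument covers both sides. *)
Definition ind (m s x : Z) : R := if Z.leb m (s * x) then 1 else 0.

(* Number of particles x with s x >= m, for a direction s = 1 or -1. *)
Definition cnt (m s : Z) (st : state) : R := sumR (ind m s) (pos st).

(** The last clause is conservation of particles: the net current from -1 to 0 is the gain in the
    number of particles at sites [x >= 0], initially [N + 1]. *)
Definition good (N : nat) (st : state) : Prop :=
  length (pos st) = nparts N /\ increasing (pos st)
  /\ IZR (flux st) = cnt 0 1 st - (INR N + 1).

Lemma not_occupied (l : list Z) (y : Z) (j : nat) :
  existsb (Z.eqb y) l = false -> (j < length l)%nat -> nth j l 0%Z <> y.
Proof.
  intros E Hj Hy. apply Bool.not_true_iff_false in E; apply E.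
  apply existsb_exists. exists y; split; [rewrite <- Hy; now apply nth_In|apply Z.eqb_refl].
Qed.

(** Order survives because a particle moves by one site and never onto an occupied one. Only a jump
    across the bond between -1 and 0 changes the count at sites [x >= 0], and the flux changes with
    it. *)
Lemma good_move (N : nat) (st : state) (i : nat) (d : Z) :
  good N st -> (i < nparts N)%nat -> (d = 1 \/ d = -1)%Z -> good N (move st i d).
Proof.
  intros (Hl & Hs & Hf) Hi Hd. unfold move.
  set (x := nth i (pos st) 0%Z).
  destruct (existsb (Z.eqb (x + d)) (pos st)) eqn:E; [now repeat split|].
  rewrite <- Hl in Hi.
  split; [|split].
  - change (length (set_nth i (x + d)%Z (pos st)) = nparts N).
    rewrite length_set_nth; auto.
  - change (increasing (set_nth i (x + d)%Z (pos st))).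
    intros j k Hjk. rewrite length_set_nth in Hjk by auto.
    rewrite !nth_set_nth by auto.
    destruct (Nat.eqb_spec j i) as [->|Hj]; destruct (Nat.eqb_spec k i) as [->|Hk]; try lia.
    + specialize (Hs i k Hjk). pose proof (not_occupied _ _ k E ltac:(lia)). fold x in Hs. lia.
    + specialize (Hs j i Hjk). pose proof (not_occupied _ _ j E ltac:(lia)). fold x in Hs. lia.
    + apply Hs; lia.
  - unfold cnt.
    change (IZR (flux st + (if ((x =? -1)%Z && (d =? 1)%Z)%bool then 1 else 0)
       - (if ((x =? 0)%Z && (d =? -1)%Z)%bool then 1 else 0)) =
      sumR (ind 0 1) (set_nth i (x + d)%Z (pos st)) - (INR N + 1)).
    rewrite (sumR_set_nth _ _ _ _ 0%Z Hi). fold x. unfold cnt in Hf.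
    rewrite minus_IZR, plus_IZR, Hf. unfold ind at 3 4.
    destruct Hd as [-> | ->];
    destruct (Z.eqb_spec x (-1)); destruct (Z.eqb_spec x 0);
    repeat match goal with |- context [Z.leb ?u ?v] => destruct (Z.leb_spec u v) end;
    try lia; simpl; lra.
Qed.

Lemma init_length (N : nat) : length (pos (init_state N)) = nparts N.
Proof. simpl. rewrite length_map, length_seq. reflexivity. Qed.

Lemma nth_init (N i : nat) :
  (i < nparts N)%nat -> nth i (pos (init_state N)) 0%Z = (Z.of_nat i - Z.of_nat N)%Z.
Proof.
  unfold nparts. intros Hi. simpl.
  rewrite nth_indep with (d' := (Z.of_nat 0 - Z.of_nat N)%Z) by (rewrite length_map, length_seq; lia).
  rewrite (map_nth (fun i => (Z.of_nat i - Z.of_nat N)%Z)), seq_nth by lia. reflexivity.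
Qed.

Lemma init_increasing (N : nat) : increasing (pos (init_state N)).
Proof.
  intros i j H. rewrite init_length in H.
  rewrite (nth_init N i), (nth_init N j) by lia. lia.
Qed.

Lemma In_init (N : nat) (x : Z) :
  In x (pos (init_state N)) <-> (Z.abs x <= Z.of_nat N)%Z.
Proof.
  simpl. rewrite in_map_iff. split.
  - intros (i & <- & Hi). apply in_seq in Hi. lia.
  - intros H. exists (Z.to_nat (x + Z.of_nat N)). rewrite in_seq. lia.
Qed.

Lemma sumR_seq_ge (n : nat) (c : Z) :
  sumR (fun i => if Z.leb c (Z.of_nat i) then 1 else 0) (seq 0 n)
  = IZR (Z.max 0 (Z.min (Z.of_nat n) (Z.of_nat n - c))).
Proof.
  induction n as [|n IH]; [simpl; f_equal; lia|].
  rewrite seq_S, sumR_app, IH. simpl sumR.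
  destruct (Z.leb_spec c (Z.of_nat n)); rewrite Rplus_0_r, <- plus_IZR; f_equal; lia.
Qed.

(** Seen as a function of the displacement [z], this lets the mean count be computed with a single
    walk started at 0. *)
Lemma sumR_init_ge (N : nat) (m z : Z) :
  sumR (fun x => ind m 1 (x + z)%Z) (pos (init_state N))
  = IZR (Z.max 0 (Z.min (2 * Z.of_nat N + 1) (Z.of_nat N + 1 + z - m))).
Proof.
  unfold init_state; cbn [pos]. rewrite sumR_map.
  rewrite (sumR_ext_in _
    (fun i => if Z.leb (m + Z.of_nat N - z) (Z.of_nat i) then 1 else 0)).
  - rewrite sumR_seq_ge. f_equal. lia.
  - intros i _. unfold ind.
    match goal with |- (if ?a then _ else _) = (if ?b then _ else _) =>
      replace a with b; [reflexivity|] end.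
    apply Bool.eq_iff_eq_true. rewrite !Z.leb_le. lia.
Qed.

Lemma good_init (N : nat) : good N (init_state N).
Proof.
  split; [apply init_length|]. split; [apply init_increasing|].
  unfold cnt. rewrite (sumR_ext_in _ (fun x => ind 0 1 (x + 0)%Z))
    by (intros; now rewrite Z.add_0_r).
  rewrite sumR_init_ge, INR_IZR_INZ, <- plus_IZR, <- minus_IZR. simpl flux. f_equal. lia.
Qed.

Lemma good_dist_k (N k : nat) : forall ws, In ws (dist_k N k) -> 0 <= fst ws /\ good N (snd ws).
Proof.
  induction k as [|k IH]; intros ws H.
  - destruct H as [<-|[]]. simpl; split; [lra|apply good_init].
  - change (dist_k N (S k)) with (step_dist (nparts N) (dist_k N k)) in H.
    apply in_flat_map in H as (w & Hw & H). apply in_flat_map in H as (i & Hi & H).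
    apply in_seq in Hi. specialize (IH w Hw) as [I1 I2].
    assert (0 < INR (nparts N)) by (apply lt_0_INR; unfold nparts; lia).
    assert (0 <= fst w / (2 * INR (nparts N)))
      by (apply Rmult_le_pos; [auto|left; apply Rinv_0_lt_compat; lra]).
    destruct H as [<-|[<-|[]]]; simpl; split; auto; apply good_move; auto; lia.
Qed.

(** * Expectations, the supermartingale bound and Markov's inequality *)

Definition mean (mu : list (R * state)) (F : state -> R) : R :=
  sumR (fun ws => fst ws * F (snd ws)) mu.

Lemma mean_step (M : nat) (mu : list (R * state)) (F : state -> R) :
  (0 < M)%nat ->
  mean (step_dist M mu) F
  = mean mu (fun s => sumR (fun i => F (move s i 1) + F (move s i (-1))) (seq 0 M) / (2 * INR M)).
Proof.
  intros HM. apply lt_0_INR in HM. unfold mean, step_dist. rewrite sumR_flat_map.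
  apply sumR_ext_in; intros w _. rewrite sumR_flat_map.
  rewrite (sumR_ext_in _ (fun i => (fst w / (2 * INR M)) *
      (F (move (snd w) i 1) + F (move (snd w) i (-1))))) by (intros; simpl; ring).
  rewrite sumR_scal. field; lra.
Qed.

Lemma mean_total (N k : nat) : mean (dist_k N k) (fun _ => 1) = 1.
Proof.
  induction k as [|k IH]; [unfold mean; simpl; ring|].
  change (dist_k N (S k)) with (step_dist (nparts N) (dist_k N k)).
  assert (0 < nparts N)%nat by (unfold nparts; lia).
  rewrite mean_step by auto. etransitivity; [|exact IH]. unfold mean.
  apply sumR_ext_in; intros w _. rewrite sumR_const, length_seq. apply lt_0_INR in H. field; lra.
Qed.

(** Backward induction: the index of [h] counts the remaining steps and rises by one with each step
    peeled off, hence the generalization over [j]. *)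
Lemma mean_wt_le (N : nat) (h : nat -> Z -> R) :
  (forall k x, h k x + gen (h k) x / (2 * INR (nparts N)) <= h (S k) x) ->
  forall k, mean (dist_k N k) (wt (h 0%nat)) <= wt (h k) (init_state N).
Proof.
  intros Hh k. cut (forall j, mean (dist_k N k) (wt (h j)) <= wt (h (j + k)%nat) (init_state N)).
  { intros H; apply (H 0%nat). }
  induction k as [|k IH]; intros j.
  - rewrite Nat.add_0_r. unfold mean; simpl. lra.
  - change (dist_k N (S k)) with (step_dist (nparts N) (dist_k N k)).
    assert (0 < nparts N)%nat by (unfold nparts; lia).
    rewrite mean_step by auto.
    rewrite Nat.add_succ_r. eapply Rle_trans; [|apply (IH (S j))].
    apply sumR_le; intros w Hw. apply good_dist_k in Hw as (Hw & Hl & Hs & _).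
    apply Rmult_le_compat_l; auto.
    eapply Rle_trans; [apply wt_one_step; auto using increasing_NoDup|].
    unfold wt.
    destruct (sumR_le (fun x => h j x + gen (h j) x / (2 * INR (nparts N))) (h (S j)) (pos (snd w))
      (fun x _ => Hh j x)) as [L|L]; [left; now apply exp_increasing|rewrite L; lra].
Qed.

Lemma prob_list_ge0 (N k : nat) (A : state -> Prop) : 0 <= prob_list (dist_k N k) A.
Proof.
  change (0 <= sumR (fun ws => if excluded_middle_informative (A (snd ws)) then fst ws else 0) (dist_k N k)).
  apply Rle_trans with (sumR (fun _ => 0) (dist_k N k)); [rewrite sumR_const; lra|].
  apply sumR_le; intros w Hw. apply good_dist_k in Hw as [Hw _].
  destruct excluded_middle_informative; lra.
Qed.

Lemma prob_list_markov (N k : nat) (A : state -> Prop) (F : state -> R) :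
  (forall s, good N s -> 0 <= F s) -> (forall s, good N s -> A s -> 1 <= F s) ->
  prob_list (dist_k N k) A <= mean (dist_k N k) F.
Proof.
  intros H0 H1. apply sumR_le; intros w Hw. apply good_dist_k in Hw as [Hw Hg].
  destruct excluded_middle_informative.
  - rewrite <- (Rmult_1_r (fst w)) at 1. apply Rmult_le_compat_l; auto.
  - apply Rmult_le_pos; auto.
Qed.

Lemma prob_list_le1 (N k : nat) (A : state -> Prop) : prob_list (dist_k N k) A <= 1.
Proof.
  rewrite <- (mean_total N k). apply prob_list_markov; intros; lra.
Qed.

Lemma prob_list_union (N k : nat) (A B C : state -> Prop) :
  (forall s, good N s -> A s -> B s \/ C s) ->
  prob_list (dist_k N k) A <= prob_list (dist_k N k) B + prob_list (dist_k N k) C.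
Proof.
  intros H. unfold prob_list.
  change (sumR (fun ws => if excluded_middle_informative (A (snd ws)) then fst ws else 0) (dist_k N k)
   <= sumR (fun ws => if excluded_middle_informative (B (snd ws)) then fst ws else 0) (dist_k N k)
    + sumR (fun ws => if excluded_middle_informative (C (snd ws)) then fst ws else 0) (dist_k N k)).
  rewrite <- sumR_plus. apply sumR_le; intros w Hw. apply good_dist_k in Hw as [Hw Hg].
  specialize (H _ Hg).
  repeat destruct excluded_middle_informative; try lra. tauto.
Qed.

(** * The free random walk *)

(* One step of a single free particle of the uniformized chain with M particles. *)
Definition avg (M : R) (f : Z -> R) (x : Z) : R :=
  f x + (f (x + 1)%Z + f (x + -1)%Z - 2 * f x) / (2 * M).

Definition walk (M : R) (k : nat) (f : Z -> R) : Z -> R := Nat.iter k (avg M) f.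

Lemma walk_S (M : R) (k : nat) (f : Z -> R) (x : Z) :
  walk M (S k) f x = avg M (walk M k f) x.
Proof. reflexivity. Qed.

Lemma avg_le (M : R) (f g : Z -> R) (x : Z) :
  1 <= M -> (forall y, f y <= g y) -> avg M f x <= avg M g x.
Proof.
  intros HM H. unfold avg.
  pose proof (H x). pose proof (H (x + 1)%Z). pose proof (H (x + -1)%Z).
  assert (0 < / (2 * M)) by (apply Rinv_0_lt_compat; lra).
  assert (/ (2 * M) <= / 2) by (apply Rinv_le_contravar; lra).
  unfold Rdiv. nra.
Qed.

Lemma walk_le (M : R) (k : nat) (f g : Z -> R) :
  1 <= M -> (forall y, f y <= g y) -> forall x, walk M k f x <= walk M k g x.
Proof.
  intros HM H. induction k as [|k IH]; intros x; [apply H|]. now apply avg_le.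
Qed.

Lemma walk_const (M : R) (k : nat) (c : R) (x : Z) : 1 <= M -> walk M k (fun _ => c) x = c.
Proof.
  intros HM. revert x; induction k as [|k IH]; intros x; [reflexivity|].
  rewrite walk_S. unfold avg. rewrite !IH. field; lra.
Qed.

Lemma walk_plus (M : R) (k : nat) (f g : Z -> R) (x : Z) :
  1 <= M -> walk M k (fun z => f z + g z) x = walk M k f x + walk M k g x.
Proof.
  intros HM. revert x; induction k as [|k IH]; intros x; [reflexivity|].
  rewrite !walk_S. unfold avg. rewrite !IH. field; lra.
Qed.

Lemma walk_scal (M : R) (k : nat) (c : R) (f : Z -> R) (x : Z) :
  1 <= M -> walk M k (fun z => c * f z) x = c * walk M k f x.
Proof.
  intros HM. revert x; induction k as [|k IH]; intros x; [reflexivity|].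
  rewrite !walk_S. unfold avg. rewrite !IH. field; lra.
Qed.

Lemma walk_sumR {A : Type} (M : R) (k : nat) (f : A -> Z -> R) (l : list A) (x : Z) :
  1 <= M -> walk M k (fun z => sumR (fun a => f a z) l) x = sumR (fun a => walk M k (f a) x) l.
Proof.
  intros HM. induction l as [|a l IH]; [exact (walk_const M k 0 x HM)|].
  simpl. rewrite <- IH, <- walk_plus by auto. reflexivity.
Qed.

Lemma walk_shift (M : R) (k : nat) (c : Z) (f : Z -> R) (x : Z) :
  walk M k (fun z => f (c + z)%Z) x = walk M k f (c + x)%Z.
Proof.
  revert x; induction k as [|k IH]; intros x; [reflexivity|].
  rewrite !walk_S. unfold avg. rewrite !IH, !Z.add_assoc. reflexivity.
Qed.

Lemma walk_opp (M : R) (k : nat) (f : Z -> R) (x : Z) :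
  walk M k (fun z => f (- z)%Z) x = walk M k f (- x)%Z.
Proof.
  revert x; induction k as [|k IH]; intros x; [reflexivity|].
  rewrite !walk_S. unfold avg. rewrite !IH.
  replace (- (x + 1))%Z with (- x + -1)%Z by lia.
  replace (- (x + -1))%Z with (- x + 1)%Z by lia. unfold Rdiv; ring.
Qed.

(** * Gaussian concentration of half-line counts *)

(** Since [exp (- d) >= 1 - d], it suffices that [(1 + d + 5/4 d^2) (1 - d) = 1 + d^2 (1 - 5 d) / 4]
    is at least 1, which is where [d <= 1/5] enters. *)
Lemma exp_le_quad (d : R) : - (1/5) <= d <= 1/5 -> exp d <= 1 + d + 5/4 * d ^ 2.
Proof.
  intros Hd. pose proof (exp_ineq1_le (- d)). pose proof (exp_pos (- d)).
  assert (E : exp d * exp (- d) = 1) by (rewrite <- exp_plus, Rplus_opp_r; apply exp_0).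
  apply Rmult_le_reg_r with (exp (- d)); auto. rewrite E.
  apply Rle_trans with ((1 + d + 5/4 * d ^ 2) * (1 + - d)); [nra|].
  apply Rmult_le_compat_l; [nra|lra].
Qed.

(** The increment factors as [d = l a c], and [l <= 1/24] keeps [c] in [[0, 1]]. So the second-order
    term of [exp d] is at most [5/4 l^2 a^2], while [d] contains [-6 l^2 a^2]; together they give
    [-19/4]. *)
Lemma quad_increment (l p a : R) :
  0 <= l <= 1/24 -> 0 <= p <= 1 -> 0 <= p + a <= 1 ->
  let d := (l * (p + a) - 6 * l ^ 2 * (p + a) ^ 2) - (l * p - 6 * l ^ 2 * p ^ 2) in
  exp d <= 1 + l * a - 12 * l ^ 2 * p * a - 19/4 * l ^ 2 * a ^ 2.
Proof.
  intros Hl Hp Ha d.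
  set (c := 1 - 6 * l * (2 * p + a)).
  assert (Hc : 0 <= c <= 1) by (unfold c; split; nra).
  assert (Hd : d = l * a * c) by (unfold d, c; ring).
  assert (Hq : d ^ 2 <= l ^ 2 * a ^ 2).
  { rewrite Hd. replace ((l * a * c) ^ 2) with (l ^ 2 * a ^ 2 * (c * c)) by ring.
    assert (0 <= l ^ 2 * a ^ 2) by nra. assert (c * c <= 1) by nra. nra. }
  assert (- (1/5) <= d <= 1/5).
  { rewrite Hd. assert (-(1/24) <= l * a <= 1/24) by (split; nra). split; nra. }
  pose proof (exp_le_quad d ltac:(assumption)). unfold d in *. nra.
Qed.

(* The concave correction -6 l^2 phi^2 turns l * phi into the exponent of a
   supermartingale: its drift absorbs the quadratic variation, particle by particle. *)
Lemma quad_supersolution (N : nat) (l : R) (f : Z -> R) :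
  (1 <= N)%nat -> 0 <= l <= 1/24 -> (forall x, 0 <= f x <= 1) ->
  let M := INR (nparts N) in
  let h k x := l * walk M k f x - 6 * l ^ 2 * walk M k f x ^ 2 in
  forall k x, h k x + gen (h k) x / (2 * M) <= h (S k) x.
Proof.
  intros HN Hl Hf M h k x.
  assert (HM : 3 <= M).
  { unfold M, nparts. replace 3 with (INR 3) by (simpl; lra). apply le_INR; lia. }
  assert (H01 : forall y, 0 <= walk M k f y <= 1).
  { intros y. split.
    - rewrite <- (walk_const M k 0 y) by lra. apply walk_le; [lra|apply Hf].
    - rewrite <- (walk_const M k 1 y) by lra. apply walk_le; [lra|apply Hf]. }
  unfold gen, h. rewrite walk_S. unfold avg.
  set (p := walk M k f x) in *.
  pose proof (H01 x) as Hp. pose proof (H01 (x + 1)%Z) as Ha. pose proof (H01 (x + -1)%Z) as Hb.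
  fold p in Hp.
  replace (walk M k f (x + 1)) with (p + (walk M k f (x + 1) - p)) in * by ring.
  replace (walk M k f (x + -1)) with (p + (walk M k f (x + -1) - p)) in * by ring.
  set (a := walk M k f (x + 1) - p) in *. set (b := walk M k f (x + -1) - p) in *.
  pose proof (quad_increment l p a Hl Hp Ha) as Ea.
  pose proof (quad_increment l p b Hl Hp Hb) as Eb. cbv zeta in Ea, Eb.
  set (ea := exp _) in Ea |- *. set (eb := exp _) in Eb |- *.
  unfold Rdiv. set (i := / (2 * M)).
  assert (Hi : 0 < i) by (apply Rinv_0_lt_compat; lra).
  assert (Hi6 : i <= 1/6).
  { unfold i. replace (1/6) with (/ 6) by lra. apply Rinv_le_contravar; lra. }
  replace (p + a + (p + b) - 2 * p) with (a + b) by ring.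
  apply Rle_trans with (l * p - 6 * l ^ 2 * p ^ 2 +
    (l * (a + b) - 12 * l ^ 2 * p * (a + b) - 19/4 * l ^ 2 * (a ^ 2 + b ^ 2)) * i).
  - apply Rplus_le_compat_l, Rmult_le_compat_r; lra.
  (* Squaring the averaged value in [h (S k)] costs [6 l^2 i^2 (a + b)^2]. As [i <= 1/6], this is at
     most [2 l^2 i (a^2 + b^2)], within the surplus [19/4]. *)
  - assert (K : i * (a + b) ^ 2 <= 1/3 * (a ^ 2 + b ^ 2)).
    { apply Rle_trans with (1/6 * (a + b) ^ 2); [apply Rmult_le_compat_r; [apply pow2_ge_0|lra]|].
      pose proof (pow2_ge_0 (a - b)). nra. }
    assert (0 <= l ^ 2 * i) by (apply Rmult_le_pos; [apply pow2_ge_0|lra]).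
    assert (l ^ 2 * i * (6 * (i * (a + b) ^ 2)) <= l ^ 2 * i * (19/4 * (a ^ 2 + b ^ 2))).
    { apply Rmult_le_compat_l; auto. pose proof (pow2_ge_0 a). pose proof (pow2_ge_0 b). lra. }
    nra.
Qed.

Lemma exp_le_compat (x y : R) : x <= y -> exp x <= exp y.
Proof. intros [H| ->]; [left; now apply exp_increasing|lra]. Qed.

Lemma ind_01 (m s x : Z) : 0 <= ind m s x <= 1.
Proof. unfold ind; destruct Z.leb; lra. Qed.

Lemma mean_scal (mu : list (R * state)) (c : R) (F : state -> R) :
  mean mu (fun s => c * F s) = c * mean mu F.
Proof.
  unfold mean. rewrite <- sumR_scal. apply sumR_ext_in; intros; ring.
Qed.

(** Exponential Chebyshev bound: the final weight is at least [exp (l cnt - 6 l^2 M)], and the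
    initial one at most [exp] of [l] times the free mean. This leaves the exponent
    [6 l^2 M - l g]. *)
Lemma cnt_concentration (N k : nat) (m s : Z) (b g : R) :
  (1 <= N)%nat -> 0 <= g <= INR N ->
  g <= b - sumR (walk (INR (nparts N)) k (ind m s)) (pos (init_state N)) ->
  prob_list (dist_k N k) (fun st => b <= cnt m s st) <= exp (- (g ^ 2 / (24 * INR (nparts N)))).
Proof.
  intros HN Hg HgA. set (M := INR (nparts N)) in *.
  set (A := sumR _ _) in HgA.
  assert (HM : M = 2 * INR N + 1)
    by (unfold M, nparts; rewrite plus_INR, mult_INR; simpl; ring).
  pose proof (pos_INR N).
  (* The minimizer of [6 l^2 M - l g]; the bound [g <= INR N] makes it at most [1/24]. *)
  set (l := g / (12 * M)).
  assert (Hlg : g = 12 * M * l) by (unfold l; field; lra).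
  assert (Hl : 0 <= l <= 1/24).
  { split; [unfold l; apply Rmult_le_pos; [lra|left; apply Rinv_0_lt_compat; lra]|]. nra. }
  set (h := fun k x => l * walk M k (ind m s) x - 6 * l ^ 2 * walk M k (ind m s) x ^ 2).
  pose proof (mean_wt_le N h (quad_supersolution N l (ind m s) HN Hl (ind_01 m s)) k) as HW.
  apply Rle_trans with
    (mean (dist_k N k) (fun st => exp (- (l * b - 6 * l ^ 2 * M)) * wt (h 0%nat) st)).
  - apply prob_list_markov.
    + intros; unfold wt; apply Rmult_le_pos; left; apply exp_pos.
    + intros st (Hlen & _) Hb. unfold wt. rewrite <- exp_plus.
      apply Rle_trans with (exp 0); [rewrite exp_0; lra|]. apply exp_le_compat.
      assert (l * cnt m s st - 6 * l ^ 2 * M <= sumR (h 0%nat) (pos st)); [|nra].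
      unfold M. rewrite <- Hlen.
      replace (l * cnt m s st - 6 * l ^ 2 * INR (length (pos st)))
        with (l * cnt m s st + INR (length (pos st)) * (- (6 * l ^ 2))) by ring.
      unfold cnt. rewrite <- sumR_scal, <- sumR_const, <- sumR_plus.
      apply sumR_le; intros x _. unfold h, walk; simpl Nat.iter.
      pose proof (ind_01 m s x). pose proof (pow2_ge_0 l).
      assert (ind m s x ^ 2 <= 1) by nra. nra.
  - rewrite mean_scal.
    apply Rle_trans with (exp (- (l * b - 6 * l ^ 2 * M)) * exp (l * A)).
    + apply Rmult_le_compat_l; [left; apply exp_pos|]. eapply Rle_trans; [apply HW|].
      apply exp_le_compat. unfold A. rewrite <- sumR_scal. apply sumR_le; intros x _.
      unfold h. fold M. set (w := walk _ _ _ _).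
      pose proof (Rmult_le_pos _ _ (pow2_ge_0 l) (pow2_ge_0 w)). lra.
    + rewrite <- exp_plus. apply exp_le_compat.
      replace (g ^ 2 / (24 * M)) with (6 * l ^ 2 * M) by (rewrite Hlg; field; lra).
      nra.
Qed.

(** * The mean number of free particles in a half line *)

Lemma walk_ext (M : R) (k : nat) (f g : Z -> R) (x : Z) :
  (forall y, f y = g y) -> walk M k f x = walk M k g x.
Proof.
  intros H. revert x; induction k as [|k IH]; intros x; [apply H|].
  rewrite !walk_S. unfold avg. rewrite !IH. reflexivity.
Qed.

Lemma sumR_init_opp (N : nat) (g : Z -> R) :
  sumR (fun x => g (- x)%Z) (pos (init_state N)) = sumR g (pos (init_state N)).
Proof.
  rewrite <- (sumR_map g Z.opp). apply sumR_perm.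
  pose proof (increasing_NoDup _ (init_increasing N)) as ND.
  apply NoDup_Permutation; auto.
  - apply FinFun.Injective_map_NoDup; auto. intros x y; lia.
  - intros x. rewrite in_map_iff, In_init. split.
    + intros (y & <- & Hy). apply In_init in Hy. lia.
    + intros Hx. exists (- x)%Z. rewrite In_init. lia.
Qed.

Definition box (N : nat) (z : Z) : R := if Z.leb (Z.abs z) (Z.of_nat N) then 1 else 0.

Definition bump (N : nat) (z : Z) : R := box N z * (1 - (IZR z / (INR N + 1)) ^ 2) ^ 2.

(** A lower bound for the principal eigenvalue of one step of the walk killed outside [[-N, N]]; the
    constant 5 is crude but suits a polynomial test function. *)
Definition decay (N : nat) : R := 1 - 5 / (2 * INR (nparts N) * (INR N + 1) ^ 2).

(* The polynomial (1 - (z/L)^2)^2 vanishes at |z| = L = N + 1, so truncating it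
   there keeps it an approximate eigenfunction from below. *)
Lemma avg_bump (N : nat) (z : Z) :
  (1 <= N)%nat -> decay N * bump N z <= avg (INR (nparts N)) (bump N) z.
Proof.
  intros HN. set (L := INR N + 1). set (M := INR (nparts N)).
  assert (HL : 2 <= L) by (apply le_INR in HN; simpl in HN; unfold L; lra).
  assert (HM : 3 <= M).
  { unfold M, nparts. replace 3 with (INR 3) by (simpl; lra). apply le_INR; lia. }
  assert (Hb : forall y, (Z.abs y <= Z.of_nat N + 1)%Z ->
     bump N y = (1 - (IZR y / L) ^ 2) ^ 2).
  { intros y Hy. unfold bump, box. fold L. destruct (Z.leb_spec (Z.abs y) (Z.of_nat N)).
    - ring.
    - assert (E : (IZR y / L) ^ 2 = 1).
      { assert (E : IZR y = L \/ IZR y = - L).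
        { unfold L. rewrite INR_IZR_INZ, <- plus_IZR, <- opp_IZR.
          destruct (Z.abs_spec y) as [[? ?]|[? ?]]; [left|right]; f_equal; lia. }
        destruct E as [-> | ->]; field; lra. }
      rewrite E. ring. }
  assert (Hpos : forall y, 0 <= bump N y).
  { intros y. unfold bump, box. destruct Z.leb; [|lra]. rewrite Rmult_1_l. apply pow2_ge_0. }
  unfold avg, decay. fold M L.
  destruct (Z_le_gt_dec (Z.abs z) (Z.of_nat N)) as [Hz|Hz].
  - rewrite !Hb by lia. rewrite !plus_IZR.
    set (y := IZR z / L). set (e := / L).
    replace ((IZR z + 1) / L) with (y + e) by (unfold y, e; field; lra).
    replace ((IZR z + -1) / L) with (y - e) by (unfold y, e; field; lra).
    set (i := / (2 * M)).
    replace (5 / (2 * M * L ^ 2)) with (5 * e ^ 2 * i) by (unfold e, i; field; lra).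
    unfold Rdiv. fold i.
    assert (Hi : 0 < i) by (apply Rinv_0_lt_compat; lra).
    (* Divided by [e^2], the defect is a polynomial in [y^2] and [e^2] whose coefficients are all
       positive thanks to the constant 5. *)
    assert (K : 0 <= ((1 - (y + e) ^ 2) ^ 2 + (1 - (y - e) ^ 2) ^ 2 - 2 * (1 - y ^ 2) ^ 2
       + 5 * e ^ 2 * (1 - y ^ 2) ^ 2)).
    { replace (_ + _) with (e ^ 2 * (5 * (y ^ 2) ^ 2 + 2 * y ^ 2 + 1 + 2 * e ^ 2)) by ring.
      apply Rmult_le_pos; [apply pow2_ge_0|].
      pose proof (pow2_ge_0 y). pose proof (pow2_ge_0 (y ^ 2)). pose proof (pow2_ge_0 e). lra. }
    apply (Rmult_le_pos i) in K; [|lra]. lra.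
  - replace (bump N z) with 0
      by (unfold bump, box; destruct (Z.leb_spec (Z.abs z) (Z.of_nat N)); [lia|ring]).
    pose proof (Hpos (z + 1)%Z). pose proof (Hpos (z + -1)%Z).
    assert (0 < / (2 * M)) by (apply Rinv_0_lt_compat; lra).
    unfold Rdiv. nra.
Qed.

(** Uses [1 - t >= exp (- 2 t)] for [0 <= t <= 1/2]. In this form the factor accumulated over
    [4 M N^2 T] steps is at least [exp (- 20 T)], uniformly in [N]. *)
Lemma decay_bounds (N : nat) :
  (1 <= N)%nat ->
  exp (- (5 / (INR (nparts N) * INR N ^ 2))) <= decay N <= 1.
Proof.
  intros HN. assert (H1 : 1 <= INR N) by (apply le_INR in HN; simpl in HN; lra).
  set (M := INR (nparts N)).
  assert (HM : 3 <= M).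
  { unfold M, nparts. replace 3 with (INR 3) by (simpl; lra). apply le_INR; lia. }
  unfold decay. fold M. set (t := 5 / (2 * M * (INR N + 1) ^ 2)).
  assert (Ht : 0 < t) by (apply Rdiv_lt_0_compat; nra).
  assert (Ht2 : t <= 1/2).
  { unfold t. apply Rmult_le_reg_r with (2 * M * (INR N + 1) ^ 2); [nra|].
    unfold Rdiv at 1. rewrite Rmult_assoc, Rinv_l by nra. nra. }
  split; [|lra].
  apply Rle_trans with (exp (- (2 * t))).
  - apply exp_le_compat, Ropp_le_contravar.
    replace (2 * t) with (5 * / (M * (INR N + 1) ^ 2)) by (unfold t; field; nra).
    unfold Rdiv. apply Rmult_le_compat_l; [lra|]. apply Rinv_le_contravar; nra.
  - pose proof (exp_ineq1_le (2 * t)). pose proof (exp_pos (- (2 * t))).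
    assert (E : exp (2 * t) * exp (- (2 * t)) = 1) by (rewrite <- exp_plus, Rplus_opp_r; apply exp_0).
    nra.
Qed.

(** [bump] lies below [box], equals 1 at 0 and loses at most the factor [decay] per step. *)
Lemma walk_box_ge (N k : nat) :
  (1 <= N)%nat -> decay N ^ k <= walk (INR (nparts N)) k (box N) 0%Z.
Proof.
  intros HN. set (M := INR (nparts N)).
  assert (HM : 1 <= M) by (unfold M, nparts; apply (le_INR 1); lia).
  assert (Hd : 0 < decay N) by (eapply Rlt_le_trans; [apply exp_pos|apply decay_bounds; auto]).
  assert (H : forall z, decay N ^ k * bump N z <= walk M k (bump N) z).
  { induction k as [|k IH]; intros z; [unfold walk; simpl; lra|].
    rewrite walk_S. apply Rle_trans with (avg M (fun y => decay N ^ k * bump N y) z).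
    - pose proof (avg_bump N z HN) as Hb. fold M in Hb.
      replace (avg M (fun y => decay N ^ k * bump N y) z) with (decay N ^ k * avg M (bump N) z)
        by (unfold avg; field; lra).
      simpl. pose proof (pow_lt _ k Hd). nra.
    - apply avg_le; auto. }
  specialize (H 0%Z).
  replace (bump N 0) with 1 in H
    by (unfold bump, box; destruct (Z.leb_spec (Z.abs 0) (Z.of_nat N)); [unfold Rdiv; ring|simpl in *; lia]).
  rewrite Rmult_1_r in H. eapply Rle_trans; [apply H|].
  apply walk_le; auto. intros y. unfold bump, box.
  destruct (Z.leb_spec (Z.abs y) (Z.of_nat N)); [|lra].
  pose proof (pos_INR N).
  assert (Hy : (IZR y / (INR N + 1)) ^ 2 <= 1).
  { assert (- INR N <= IZR y <= INR N)
      by (rewrite INR_IZR_INZ, <- opp_IZR; split; apply IZR_le; lia).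
    unfold Rdiv. rewrite Rpow_mult_distr, pow_inv.
    apply Rmult_le_reg_r with ((INR N + 1) ^ 2); [nra|].
    rewrite Rmult_assoc, Rinv_l by nra. nra. }
  pose proof (pow2_ge_0 (IZR y / (INR N + 1))). nra.
Qed.

(** Moving the starting points into the test function turns the mean into one walk from 0 applied to
    [H z], the count for the initial block translated by [z]. Symmetry of the walk allows averaging
    [H z] with [H (- z)]. *)
Lemma mean_cnt_le (N k : nat) (m s : Z) :
  (1 <= N)%nat -> (0 <= m <= Z.of_nat N)%Z -> (s = 1 \/ s = -1)%Z ->
  sumR (walk (INR (nparts N)) k (ind m s)) (pos (init_state N))
  <= INR N + 1 - IZR m / 2 * decay N ^ k.
Proof.
  intros HN Hm Hs. set (M := INR (nparts N)).
  assert (HM : 1 <= M) by (unfold M, nparts; apply (le_INR 1); lia).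
  replace (sumR (walk M k (ind m s)) (pos (init_state N)))
    with (sumR (walk M k (ind m 1)) (pos (init_state N))).
  2:{ destruct Hs as [-> | ->]; [reflexivity|].
      rewrite <- sumR_init_opp. apply sumR_ext_in; intros x _.
      rewrite <- walk_opp. apply walk_ext; intros y.
      unfold ind. replace (1 * - y)%Z with (-1 * y)%Z by lia. reflexivity. }
  set (H := fun z => sumR (fun x => ind m 1 (x + z)%Z) (pos (init_state N))).
  assert (E : sumR (walk M k (ind m 1)) (pos (init_state N)) = walk M k H 0%Z).
  { unfold H. rewrite walk_sumR by auto. apply sumR_ext_in; intros x _.
    rewrite walk_shift, Z.add_0_r. reflexivity. }
  assert (E2 : 2 * walk M k H 0%Z = walk M k (fun z => H z + H (- z)%Z) 0%Z).
  { rewrite walk_plus, (walk_opp M k H) by auto. simpl Z.opp. lra. }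
  (* Unclipped, [H z + H (- z)] is [2 N + 2 - 2 m]. For [|z| <= N], clipping one term at 0 still
     leaves a loss of at least [m]; for larger [|z|] only [2 N + 2] is kept. *)
  assert (E3 : walk M k (fun z => H z + H (- z)%Z) 0%Z
     <= walk M k (fun z => (2 * INR N + 2) + (- IZR m) * box N z) 0%Z).
  { apply walk_le; auto. intros z. unfold H. rewrite !sumR_init_ge.
    unfold box. rewrite INR_IZR_INZ.
    destruct (Z.leb_spec (Z.abs z) (Z.of_nat N)).
    - rewrite Rmult_1_r, <- plus_IZR, <- mult_IZR, <- opp_IZR, <- !plus_IZR. apply IZR_le. lia.
    - rewrite Rmult_0_r, Rplus_0_r, <- plus_IZR, <- mult_IZR, <- !plus_IZR. apply IZR_le. lia. }
  rewrite <- E2, (walk_plus M k (fun _ => 2 * INR N + 2)), walk_const, walk_scal in E3 by auto.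
  pose proof (walk_box_ge N k HN) as W. fold M in W.
  assert (0 <= IZR m) by (apply IZR_le; lia). rewrite E. nra.
Qed.

(** * Exponential test functions for large displacements *)

Lemma exp_le_inv (x y : R) : exp x <= exp y -> x <= y.
Proof.
  intros H. destruct (Rle_lt_dec x y) as [L|L]; [auto|]. apply exp_increasing in L. lra.
Qed.

Lemma exp_pow (y : R) (k : nat) : exp y ^ k = exp (y * INR k).
Proof.
  induction k as [|k IH]; [simpl; rewrite Rmult_0_r, exp_0; reflexivity|].
  rewrite S_INR. simpl. rewrite IH, <- exp_plus. f_equal; ring.
Qed.

(* Here h = ln (1 + v) with v growing geometrically: all drifts are nonnegative. *)
Lemma expo_supersolution (N : nat) (al b : R) (m s : Z) :
  0 <= al <= 1/5 -> (s = 1 \/ s = -1)%Z ->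
  let M := INR (nparts N) in
  let r := 1 + 5 * al ^ 2 / (2 * M) in
  let h k x := ln (1 + exp (b + al * IZR (s * x - m)) * r ^ k) in
  forall k x, h k x + gen (h k) x / (2 * M) <= h (S k) x.
Proof.
  intros Hal Hs M r h k x.
  assert (HM : 1 <= M) by (unfold M, nparts; apply (le_INR 1); lia).
  assert (Hr : 1 <= r).
  { unfold r. assert (0 <= 5 * al ^ 2 / (2 * M)); [|lra].
    apply Rmult_le_pos; [nra|left; apply Rinv_0_lt_compat; lra]. }
  assert (Hrk : forall j, 0 < r ^ j) by (intros; apply pow_lt; lra).
  set (v := fun x => exp (b + al * IZR (s * x - m)) * r ^ k).
  assert (Hv : forall y, 0 < v y) by (intros; apply Rmult_lt_0_compat; [apply exp_pos|auto]).
  assert (Hh : forall y, h k y = ln (1 + v y)) by reflexivity.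
  assert (Hd : forall y, exp (h k y - h k x) = (1 + v y) / (1 + v x)).
  { intros y. rewrite !Hh. unfold Rminus. rewrite exp_plus, exp_Ropp.
    pose proof (Hv x); pose proof (Hv y). rewrite !exp_ln by lra. reflexivity. }
  set (E := exp al + exp (- al)).
  assert (HE : E <= 2 + 5/2 * al ^ 2).
  { pose proof (exp_le_quad al ltac:(lra)). pose proof (exp_le_quad (- al) ltac:(lra)).
    unfold E. nra. }
  assert (Hsum : v (x + 1)%Z + v (x + -1)%Z = v x * E).
  { assert (Hsh : forall e, v (x + e)%Z = v x * exp (al * IZR (s * e))).
    { intros e. unfold v. rewrite Rmult_assoc, (Rmult_comm (r ^ k)), <- Rmult_assoc, <- exp_plus.
      do 2 f_equal. rewrite !minus_IZR, !mult_IZR, plus_IZR. ring. }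
    rewrite !Hsh, <- Rmult_plus_distr_l. f_equal. unfold E.
    destruct Hs as [-> | ->]; simpl Z.mul; rewrite ?Rmult_1_r;
      replace (al * -1) with (- al) by ring; [reflexivity|apply Rplus_comm]. }
  pose proof (Hv x) as Hvx.
  (* This drift bound is such that [(1 + v x) (1 + 2 a)] equals [1 + r v x], so only
     [exp a <= 1 + 2 a] remains. *)
  set (a := 5/4 * al ^ 2 * v x / (M * (1 + v x))).
  assert (Hg : gen (h k) x / (2 * M) <= a).
  { unfold gen. rewrite !Hd.
    replace ((1 + v (x + 1)%Z) / (1 + v x) + (1 + v (x + -1)%Z) / (1 + v x) - 2)
      with ((v (x + 1)%Z + v (x + -1)%Z - 2 * v x) / (1 + v x)) by (field; lra).
    rewrite Hsum.
    replace a with ((v x * (5/2 * al ^ 2)) / (1 + v x) / (2 * M)) by (unfold a; field; lra).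
    unfold Rdiv. repeat apply Rmult_le_compat_r;
      try (left; apply Rinv_0_lt_compat; lra). nra. }
  assert (Ha : 0 <= a <= 1/5).
  { unfold a. split.
    - apply Rmult_le_pos; [nra|left; apply Rinv_0_lt_compat; nra].
    - apply Rmult_le_reg_r with (M * (1 + v x)); [nra|].
      unfold Rdiv at 1. rewrite Rmult_assoc, Rinv_l by nra.
      assert (al ^ 2 <= 1/25) by nra. nra. }
  assert (Hea : exp a <= 1 + 2 * a) by (pose proof (exp_le_quad a ltac:(lra)); nra).
  apply Rle_trans with (h k x + a); [lra|].
  apply exp_le_inv. unfold h at 2.
  assert (Hgrow : exp (b + al * IZR (s * x - m)) * r ^ S k = v x * r) by (unfold v; simpl; ring).
  rewrite Hgrow, exp_plus, Hh, !exp_ln by nra.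
  apply Rle_trans with ((1 + v x) * (1 + 2 * a)); [apply Rmult_le_compat_l; lra|].
  right. unfold a, r. field. lra.
Qed.

(** At the end [ln (1 + v)] is at least [b] on the half line and nonnegative elsewhere. The
    inequality assumed on [b] makes [v <= 1] at every initial site, so each of the [M] particles
    starts with at most [ln 2 < 1]. *)
Lemma cnt_far_tail (N k : nat) (m s : Z) (al b : R) :
  0 <= al <= 1/5 -> 0 <= b -> (s = 1 \/ s = -1)%Z ->
  let M := INR (nparts N) in
  b + al * (INR N - IZR m) + 5 * al ^ 2 / (2 * M) * INR k <= 0 ->
  prob_list (dist_k N k) (fun st => INR N + 1 <= cnt m s st) <= exp (M - (INR N + 1) * b).
Proof.
  intros Hal Hb Hs M Hneg.
  assert (HM : 1 <= M) by (unfold M, nparts; apply (le_INR 1); lia).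
  set (r := 1 + 5 * al ^ 2 / (2 * M)).
  assert (Hr : 1 <= r).
  { unfold r. assert (0 <= 5 * al ^ 2 / (2 * M)); [|lra].
    apply Rmult_le_pos; [nra|left; apply Rinv_0_lt_compat; lra]. }
  set (h := fun k x => ln (1 + exp (b + al * IZR (s * x - m)) * r ^ k)).
  pose proof (mean_wt_le N h (expo_supersolution N al b m s Hal Hs) k) as HW.
  apply Rle_trans with (mean (dist_k N k) (fun st => exp (- ((INR N + 1) * b)) * wt (h 0%nat) st)).
  - apply prob_list_markov.
    + intros; unfold wt; apply Rmult_le_pos; left; apply exp_pos.
    + intros st _ Hc. unfold wt. rewrite <- exp_plus.
      apply Rle_trans with (exp 0); [rewrite exp_0; lra|]. apply exp_le_compat.
      assert (b * cnt m s st <= sumR (h 0%nat) (pos st)); [|nra].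
      unfold cnt. rewrite <- sumR_scal. apply sumR_le; intros x _. unfold h, ind.
      rewrite pow_O, Rmult_1_r.
      set (e := b + _). pose proof (exp_pos e).
      apply exp_le_inv. rewrite exp_ln by lra.
      destruct (Z.leb_spec m (s * x)).
      * assert (0 <= IZR (s * x - m)) by (apply IZR_le; lia).
        assert (b <= e) by (unfold e; nra).
        rewrite Rmult_1_r. pose proof (exp_le_compat b e). lra.
      * rewrite Rmult_0_r, exp_0. lra.
  - rewrite mean_scal.
    apply Rle_trans with (exp (- ((INR N + 1) * b)) * exp M).
    + apply Rmult_le_compat_l; [left; apply exp_pos|]. eapply Rle_trans; [apply HW|].
      apply exp_le_compat.
      replace M with (INR (length (pos (init_state N))) * 1)
        by (rewrite init_length; unfold M; ring).
      rewrite <- sumR_const. apply sumR_le; intros x Hx. apply In_init in Hx.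
      unfold h. set (v := exp _ * r ^ k).
      assert (Hv : v <= 1).
      { rewrite <- exp_0. unfold v.
        apply Rle_trans with (exp (b + al * (INR N - IZR m)) * exp (5 * al ^ 2 / (2 * M) * INR k)).
        - apply Rmult_le_compat; [left; apply exp_pos|apply pow_le; lra| |].
          + apply exp_le_compat, Rplus_le_compat_l, Rmult_le_compat_l; [lra|].
            rewrite INR_IZR_INZ, <- minus_IZR. apply IZR_le. lia.
          + apply Rle_trans with (exp (5 * al ^ 2 / (2 * M)) ^ k).
            * apply pow_incr. split; [lra|apply exp_ineq1_le].
            * right. apply exp_pow.
        - rewrite <- exp_plus. now apply exp_le_compat. }
      assert (0 < v) by (apply Rmult_lt_0_compat; [apply exp_pos|apply pow_lt; lra]).
      apply exp_le_inv. rewrite exp_ln by lra. pose proof (exp_ineq1_le 1). lra.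
    + rewrite <- exp_plus. apply exp_le_compat. lra.
Qed.

(** * Passage to continuous time through the Poisson number of steps *)

Lemma exp_series (c x : R) :
  Un_cv (sum_f_R0 (fun k => c * (/ INR (fact k) * x ^ k))) (c * exp x).
Proof.
  apply Un_cv_ext with (fun n => c * E1 x n).
  - intros n. unfold E1. rewrite scal_sum. apply sum_eq; intros; ring.
  - apply CV_mult; [|apply E1_cvg].
    intros eps He. exists 0%nat. intros; rewrite Rdist_eq; auto.
Qed.

(* Poisson(L) puts mass at most e^(-L) beyond 4L, since E[2^K] = e^L and e < 4. *)
Lemma prob_at_le (N : nat) (t B : R) (A : state -> Prop) :
  0 <= t -> 0 <= B ->
  let L := INR (nparts N) * t in
  (forall k, INR k <= 4 * L -> prob_list (dist_k N k) A <= B) ->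
  prob_at N t A <= B + exp (- L).
Proof.
  intros Ht HB L Hk.
  assert (HL : 0 <= L) by (apply Rmult_le_pos; [apply pos_INR|auto]).
  assert (Hp : forall k, prob_list (dist_k N k) A <= B + exp (- (2 * L)) * 2 ^ k).
  { intros k. pose proof (exp_pos (- (2 * L))). assert (0 < 2 ^ k) by (apply pow_lt; lra).
    destruct (Rle_lt_dec (INR k) (4 * L)) as [H1|H1].
    - specialize (Hk k H1). nra.
    - pose proof (prob_list_le1 N k A).
      assert (1 <= exp (- (2 * L)) * 2 ^ k); [|lra].
      apply Rle_trans with (exp (- (2 * L)) * exp (1/2 * INR k)).
      + rewrite <- exp_plus. apply Rle_trans with (exp 0); [rewrite exp_0; lra|].
        apply exp_le_compat. lra.
      + apply Rmult_le_compat_l; [lra|]. rewrite <- exp_pow. apply pow_incr.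
        split; [left; apply exp_pos|].
        assert (exp (1/2) * exp (1/2) = exp 1) by (rewrite <- exp_plus; f_equal; lra).
        pose proof exp_le_3. pose proof (exp_pos (1/2)). nra. }
  set (u := fun k => exp (- L) * L ^ k / INR (fact k) * prob_list (dist_k N k) A).
  set (w := fun k => (exp (- L) * B) * (/ INR (fact k) * L ^ k)
              + exp (- (3 * L)) * (/ INR (fact k) * (2 * L) ^ k)).
  assert (Hu : forall k, 0 <= u k <= w k).
  { intros k. unfold u, w.
    assert (Hf : 0 < / INR (fact k)) by (apply Rinv_0_lt_compat, INR_fact_lt_0).
    pose proof (pow_le L k HL). pose proof (exp_pos (- L)).
    assert (0 <= exp (- L) * L ^ k / INR (fact k)).
    { unfold Rdiv. apply Rmult_le_pos; [apply Rmult_le_pos|]; lra. }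
    split; [apply Rmult_le_pos; [auto|apply prob_list_ge0]|].
    apply Rle_trans with (exp (- L) * L ^ k / INR (fact k) * (B + exp (- (2 * L)) * 2 ^ k)).
    - apply Rmult_le_compat_l; auto.
    - right. replace (- (3 * L)) with (- L + - (2 * L)) by ring.
      rewrite exp_plus, Rpow_mult_distr. unfold Rdiv. ring. }
  assert (Hw : Un_cv (sum_f_R0 w) (B + exp (- L))).
  { pose proof (CV_plus _ _ _ _ (exp_series (exp (- L) * B) L)
      (exp_series (exp (- (3 * L))) (2 * L))) as H.
    replace (B + exp (- L)) with (exp (- L) * B * exp L + exp (- (3 * L)) * exp (2 * L)).
    - eapply Un_cv_ext; [|exact H]. intros n. symmetry. apply plus_sum.
    - rewrite <- exp_plus. replace (- (3 * L) + 2 * L) with (- L) by ring.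
      replace (exp (- L) * B * exp L) with (B * (exp (- L) * exp L)) by ring.
      rewrite <- exp_plus, Rplus_opp_l, exp_0. ring. }
  destruct (Rseries_CV_comp u w Hu (exist _ _ Hw)) as [p Hpu].
  (* [prob_at] is an [epsilon] choice: its value is known only once the series is shown to converge,
     by uniqueness of the sum. *)
  assert (Hep : prob_at N t A = p).
  { apply (uniqueness_sum u); [|exact Hpu].
    unfold prob_at. apply epsilon_spec. exists p. exact Hpu. }
  rewrite Hep. refine (Rle_cv_lim _ Hpu Hw).
  intros n. apply sum_Rle. intros; apply Hu.
Qed.

(** * From the current and the tagged particle to half-line counts *)

Lemma INR_nparts (N : nat) : INR (nparts N) = 2 * INR N + 1.
Proof. unfold nparts. rewrite plus_INR, mult_INR. simpl. ring. Qed.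

Lemma cnt_bounds (N : nat) (st : state) (m s : Z) :
  good N st -> 0 <= cnt m s st <= INR (nparts N).
Proof.
  intros (Hl & _). rewrite <- Hl. unfold cnt. split.
  - replace 0 with (INR (length (pos st)) * 0) by ring. rewrite <- sumR_const.
    apply sumR_le; intros; apply ind_01.
  - rewrite <- (Rmult_1_r (INR _)), <- sumR_const. apply sumR_le; intros; apply ind_01.
Qed.

(** The current is a count between 0 and [2 N + 1], minus [N + 1]. This gives the rate minus
    infinity for [a > 1]. *)
Lemma J_le (N : nat) (st : state) : good N st -> IZR (Z.abs (J st)) <= INR N + 1.
Proof.
  intros Hg. pose proof (cnt_bounds N st 0 1 Hg) as H. rewrite INR_nparts in H.
  destruct Hg as (_ & _ & Hf). rewrite abs_IZR. unfold J. rewrite Hf.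
  apply Rabs_le. lra.
Qed.

(** A negative current leaves a deficit on the right; the two closed half lines cover all [2 N + 1]
    particles, so the left one has the excess. The constant [INR N + c] fits both signs. *)
Lemma cnt_of_J (N : nat) (st : state) (c : R) :
  good N st -> c <= IZR (Z.abs (J st)) ->
  INR N + c <= cnt 0 1 st \/ INR N + c <= cnt 0 (-1) st.
Proof.
  intros (Hl & _ & Hf) Hc. rewrite abs_IZR in Hc. unfold J in Hc. rewrite Hf in Hc.
  assert (H : INR (nparts N) <= cnt 0 1 st + cnt 0 (-1) st).
  { rewrite <- Hl, <- (Rmult_1_r (INR _)), <- sumR_const. unfold cnt. rewrite <- sumR_plus.
    apply sumR_le; intros x _. unfold ind.
    destruct (Z.leb_spec 0 (1 * x)); destruct (Z.leb_spec 0 (-1 * x)); try lia; lra. }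
  rewrite INR_nparts in H. unfold Rabs in Hc. destruct Rcase_abs; [right|left]; lra.
Qed.

(** By order, a tagged particle at or right of [m] has the labels [N] to [2 N] there too, and one at
    or left of [-m] the labels [0] to [N]: [N + 1] particles either way. *)
Lemma cnt_of_tagged (N : nat) (st : state) (m : Z) :
  good N st -> (m <= Z.abs (tagged N st))%Z ->
  INR N + 1 <= cnt m 1 st \/ INR N + 1 <= cnt m (-1) st.
Proof.
  unfold tagged. intros (Hl & Hs & _) Hm.
  assert (Hmono : forall i j, (i <= j < nparts N)%nat ->
    (nth i (pos st) 0 <= nth j (pos st) 0)%Z).
  { intros i j Hij. destruct (Nat.eq_dec i j) as [->|Hn]; [lia|].
    specialize (Hs i j ltac:(lia)). lia. }
  pose proof (sumR_seq_ge (nparts N) (Z.of_nat N)) as E1.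
  pose proof (sumR_seq_ge (nparts N) (Z.of_nat N + 1)) as E2.
  replace (Z.max _ _) with (Z.of_nat N + 1)%Z in E1 by (unfold nparts; lia).
  replace (Z.max _ _) with (Z.of_nat N) in E2 by (unfold nparts; lia).
  rewrite plus_IZR, <- INR_IZR_INZ in E1. rewrite <- INR_IZR_INZ in E2.
  destruct (Z_le_gt_dec 0 (nth N (pos st) 0%Z)) as [Hz|Hz]; [left|right];
    unfold cnt; rewrite <- (sumR_nth _ _ 0%Z), Hl.
  - rewrite <- E1. apply sumR_le; intros i Hi. apply in_seq in Hi. unfold ind.
    destruct (Z.leb_spec (Z.of_nat N) (Z.of_nat i)); destruct Z.leb eqn:E; try lra.
    apply Z.leb_gt in E. specialize (Hmono N i ltac:(lia)). lia.
  - replace (INR N + 1) with (INR (nparts N) * 1 + (-1) * INR N) by (rewrite INR_nparts; ring).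
    rewrite <- E2, <- sumR_scal. rewrite <- (length_seq (nparts N) 0) at 1.
    rewrite <- sumR_const, <- sumR_plus.
    apply sumR_le; intros i Hi. apply in_seq in Hi. unfold ind.
    destruct (Z.leb_spec (Z.of_nat N + 1) (Z.of_nat i)); destruct Z.leb eqn:E; try lra.
    apply Z.leb_gt in E. specialize (Hmono i N ltac:(unfold nparts in *; lia)). lia.
Qed.

(** * Tail bounds for a fixed number of steps *)

(** The free mean is at most [N + 1], so the gap is [a N - 1]. The 1 in the exponent absorbs the
    cross term of its square, and 72 comes from [24 (2 N + 1) <= 72 N]. *)
Lemma J_tail (N k : nat) (a : R) :
  (1 <= N)%nat -> 0 <= a <= 1 -> 1 <= a * INR N ->
  prob_list (dist_k N k) (fun st => a * INR N <= IZR (Z.abs (J st)))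
  <= 2 * exp (1 - a ^ 2 / 72 * INR N).
Proof.
  intros HN Ha H1. pose proof (le_INR _ _ HN) as HN1. simpl in HN1.
  eapply Rle_trans; [apply (prob_list_union N k _
    (fun st => INR N + a * INR N <= cnt 0 1 st) (fun st => INR N + a * INR N <= cnt 0 (-1) st))|].
  { intros st Hg. now apply cnt_of_J. }
  assert (HT : forall s, (s = 1 \/ s = -1)%Z ->
    prob_list (dist_k N k) (fun st => INR N + a * INR N <= cnt 0 s st)
    <= exp (1 - a ^ 2 / 72 * INR N)).
  { intros s Hs. eapply Rle_trans.
    - apply (cnt_concentration N k 0 s _ (a * INR N - 1)); [auto|nra|].
      pose proof (mean_cnt_le N k 0 s HN ltac:(lia) Hs) as H. lra.
    - apply exp_le_compat. rewrite INR_nparts.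
      apply Rle_trans with (- ((a * INR N - 1) ^ 2 / (72 * INR N))).
      + apply Ropp_le_contravar. unfold Rdiv. apply Rmult_le_compat_l; [apply pow2_ge_0|].
        apply Rinv_le_contravar; lra.
      + apply Rmult_le_reg_r with (72 * INR N); [lra|].
        replace (- ((a * INR N - 1) ^ 2 / (72 * INR N)) * (72 * INR N))
          with (- (a * INR N - 1) ^ 2) by (field; lra).
        nra. }
  pose proof (HT 1%Z ltac:(auto)). pose proof (HT (-1)%Z ltac:(auto)). lra.
Qed.

Lemma ceil_ex (x : R) : exists m : Z, x <= IZR m < x + 1.
Proof.
  exists (1 - up (- x))%Z. rewrite minus_IZR. pose proof (archimed (- x)). lra.
Qed.

Lemma tagged_tail_of_cnt (N k : nat) (x B : R) (m : Z) :
  IZR m < x + 1 ->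
  (forall s, (s = 1 \/ s = -1)%Z ->
    prob_list (dist_k N k) (fun st => INR N + 1 <= cnt m s st) <= B) ->
  prob_list (dist_k N k) (fun st => x <= IZR (Z.abs (tagged N st))) <= 2 * B.
Proof.
  intros Hm HB. eapply Rle_trans; [apply (prob_list_union N k _
    (fun st => INR N + 1 <= cnt m 1 st) (fun st => INR N + 1 <= cnt m (-1) st))|].
  { intros st Hg Hx. apply cnt_of_tagged; auto.
    apply Z.lt_succ_r, lt_IZR. rewrite succ_IZR. lra. }
  pose proof (HB 1%Z ltac:(auto)). pose proof (HB (-1)%Z ltac:(auto)). lra.
Qed.

(** The threshold [N + 1] exceeds the free mean by at least [a N q / 2] with [q = exp (- 20 T)]. Its
    square over [24 M <= 72 N] gives the constant 288. *)
Lemma tagged_tail_moderate (N k : nat) (a T : R) :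
  (1 <= N)%nat -> 0 <= a <= 1 -> 0 < T -> INR k <= 4 * (INR (nparts N) * (INR N ^ 2 * T)) ->
  prob_list (dist_k N k) (fun st => a * INR N <= IZR (Z.abs (tagged N st)))
  <= 2 * exp (- (exp (- (20 * T)) ^ 2 / 288 * a ^ 2 * INR N)).
Proof.
  intros HN Ha HT Hk. pose proof (le_INR _ _ HN) as HN1. simpl in HN1.
  destruct (ceil_ex (a * INR N)) as [m Hm].
  apply (tagged_tail_of_cnt N k _ _ m); [apply Hm|]. intros s Hs.
  assert (Hm0 : (0 <= m)%Z).
  { apply Z.lt_succ_r, lt_IZR. rewrite succ_IZR. nra. }
  assert (HmN : (m <= Z.of_nat N)%Z).
  { apply Z.lt_succ_r, lt_IZR. rewrite succ_IZR, <- INR_IZR_INZ. nra. }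
  pose proof (decay_bounds N HN) as [D1 D2].
  set (q := exp (- (20 * T))).
  assert (HM : 3 <= INR (nparts N)) by (rewrite INR_nparts; lra).
  assert (Hq : q <= decay N ^ k).
  { apply Rle_trans with (exp (- (5 / (INR (nparts N) * INR N ^ 2))) ^ k).
    - rewrite exp_pow. apply exp_le_compat.
      set (M := INR (nparts N)) in *.
      assert (Hi : 0 < / (M * INR N ^ 2)) by (apply Rinv_0_lt_compat; nra).
      apply (Rmult_le_compat_l _ _ _ (Rlt_le _ _ Hi)) in Hk.
      replace (/ (M * INR N ^ 2) * (4 * (M * (INR N ^ 2 * T)))) with (4 * T) in Hk
        by (field; nra).
      unfold Rdiv. lra.
    - apply pow_incr. split; [left; apply exp_pos|auto]. }
  assert (Hq0 : 0 < q) by apply exp_pos.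
  assert (Hd1 : decay N ^ k <= 1).
  { rewrite <- (pow1 k). apply pow_incr. split; [|auto].
    left. eapply Rlt_le_trans; [apply exp_pos|apply D1]. }
  assert (HmR : 0 <= IZR m <= INR N) by (rewrite INR_IZR_INZ; split; apply IZR_le; lia).
  set (g := IZR m / 2 * decay N ^ k).
  assert (Hg : a * INR N / 2 * q <= g).
  { apply Rmult_le_compat; nra. }
  eapply Rle_trans.
  - apply (cnt_concentration N k m s _ g); [auto|unfold g; split; nra|].
    pose proof (mean_cnt_le N k m s HN ltac:(lia) Hs). unfold g. lra.
  - apply exp_le_compat, Ropp_le_contravar.
    apply Rle_trans with ((a * INR N / 2 * q) ^ 2 / (24 * (3 * INR N))).
    + right. field. lra.
    + unfold Rdiv at 1 3. apply Rmult_le_compat.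
      * apply pow2_ge_0.
      * left; apply Rinv_0_lt_compat; lra.
      * apply pow_incr. split; [|auto]. repeat apply Rmult_le_pos; lra.
      * apply Rinv_le_contravar; [lra|]. rewrite INR_nparts. lra.
Qed.

Lemma tagged_tail_large (N k : nat) (a T : R) :
  let B := 10 * T + 1 in
  0 < T -> 96 * B <= a -> 2 * a <= INR N ->
  INR k <= 4 * (INR (nparts N) * (INR N ^ 2 * T)) ->
  prob_list (dist_k N k) (fun st => a * INR N <= IZR (Z.abs (tagged N st)))
  <= 2 * exp (- (/ (32 * B) * a ^ 2 * INR N)).
Proof.
  intros B HT Ha HN Hk.
  assert (HB : 1 <= B) by (unfold B; lra).
  destruct (ceil_ex (a * INR N)) as [m Hm].
  apply (tagged_tail_of_cnt N k _ _ m); [apply Hm|]. intros s Hs.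
  (* With slope [u / N], the growth over [k] steps costs at most [10 T u^2 = (B - 1) u^2], while the
     distance gains [u (a - 1)]. Taking [a = 4 B u] leaves room for [b = B u^2], and [u >= 24] lets
     [b] beat the term [M] of the far-tail bound. *)
  set (u := a / (4 * B)).
  assert (Hu : 4 * B * u = a) by (unfold u; field; lra).
  assert (Hu0 : 0 < u) by (apply Rdiv_lt_0_compat; lra).
  set (b := B * u ^ 2).
  assert (Hb : 6 <= b / 2) by (unfold b; nra).
  replace (/ (32 * B) * a ^ 2 * INR N) with (b / 2 * INR N)
    by (unfold b; rewrite <- Hu; field; lra).
  set (al := u / INR N).
  assert (Hal : al * INR N = u) by (unfold al; field; lra).
  assert (Hal0 : 0 < al) by (apply Rdiv_lt_0_compat; lra).
  assert (HM := INR_nparts N).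
  eapply Rle_trans.
  - assert (al <= 1/5) by nra.
    apply (cnt_far_tail N k m s al b); [lra|lra|auto|].
    assert (E1 : al * (INR N - IZR m) <= u * (1 - a)) by nra.
    assert (E2 : 5 * al ^ 2 / (2 * INR (nparts N)) * INR k <= 10 * T * u ^ 2).
    { eapply Rle_trans; [apply Rmult_le_compat_l; [|apply Hk]|].
      - apply Rmult_le_pos; [nra|left; apply Rinv_0_lt_compat; lra].
      - right. rewrite <- Hal. field. lra. }
    unfold b, B in *. nra.
  - apply exp_le_compat. rewrite HM. nra.
Qed.

(** * Combining the estimates as [N] grows *)

(** The constants are absorbed by [2 exp 1 + 1 <= exp 3] and the slack [N eps >= 3]; [L] is the
    Poisson exponent. *)
Lemma combine_tails (N L c eps x p : R) :
  p <= 2 * exp (1 - x) + exp (- L) -> N * c <= x -> N * c <= L -> 3 <= N * eps ->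
  p <= exp (N * (- c + eps)).
Proof.
  intros Hp Hx HL He.
  apply Rle_trans with (exp (- (N * c)) * exp 3).
  - assert (E1 : exp (1 - x) <= exp (- (N * c)) * exp 1)
      by (rewrite <- exp_plus; apply exp_le_compat; lra).
    assert (E2 : exp (- L) <= exp (- (N * c))) by (apply exp_le_compat; lra).
    assert (E3 : exp 3 = exp 1 * exp 1 * exp 1) by (rewrite <- !exp_plus; f_equal; lra).
    pose proof (exp_pos (- (N * c))). pose proof (exp_ineq1_le 1).
    assert (2 * exp 1 + 1 <= exp 3) by (rewrite E3; nra).
    nra.
  - rewrite <- exp_plus. apply exp_le_compat. lra.
Qed.

Lemma eventually_ge (x : R) : exists n : nat, forall N : nat, (n <= N)%nat -> x <= INR N.
Proof.
  destruct (INR_unbounded x) as [n Hn]. exists n. intros N H. apply le_INR in H. lra.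
Qed.

(** The Poisson exponent is of order [N^3], so it beats any linear rate [c N]. *)
Lemma eventually_large (T c eps x : R) :
  0 < T -> 0 < eps ->
  exists N0 : nat, forall N : nat, (N0 <= N)%nat ->
    (1 <= N)%nat /\ INR N * c <= INR (nparts N) * (INR N ^ 2 * T)
    /\ 3 <= INR N * eps /\ x <= INR N.
Proof.
  intros HT He.
  destruct (eventually_ge (c / T)) as [n1 H1]. destruct (eventually_ge (3 / eps)) as [n2 H2].
  destruct (eventually_ge x) as [n3 H3].
  exists (1 + n1 + n2 + n3)%nat. intros N HN.
  specialize (H1 N ltac:(lia)). specialize (H2 N ltac:(lia)). specialize (H3 N ltac:(lia)).
  assert (HN1 : (1 <= N)%nat) by lia.
  repeat split; auto.
  - pose proof (le_INR _ _ HN1) as H. simpl in H. rewrite INR_nparts.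
    assert (c <= INR N * T).
    { replace c with (c / T * T) by (field; lra). apply Rmult_le_compat_r; lra. }
    apply Rle_trans with (INR N * (INR N * T)); [apply Rmult_le_compat_l; lra|].
    replace ((2 * INR N + 1) * (INR N ^ 2 * T))
      with (INR N * (INR N * T) * (2 * INR N + 1)) by ring.
    assert (0 <= INR N * (INR N * T)) by (repeat apply Rmult_le_pos; lra). nra.
  - replace 3 with (3 / eps * eps) by (field; lra). apply Rmult_le_compat_r; lra.
Qed.

Lemma prob_list_le (N k : nat) (A A' : state -> Prop) :
  (forall s, good N s -> A s -> A' s) ->
  prob_list (dist_k N k) A <= prob_list (dist_k N k) A'.
Proof.
  intros H. apply sumR_le; intros w Hw. apply good_dist_k in Hw as [Hw Hg].
  specialize (H _ Hg). repeat destruct excluded_middle_informative; try lra. tauto.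
Qed.

Lemma prob_at_impossible (N : nat) (t : R) (A : state -> Prop) :
  (forall s, good N s -> ~ A s) -> prob_at N t A = 0.
Proof.
  intros HA.
  assert (H0 : forall k, prob_list (dist_k N k) A = 0).
  { intros k. apply Rle_antisym; [|apply prob_list_ge0].
    eapply Rle_trans; [apply (prob_list_markov N k A (fun _ => 0))|].
    - intros; lra.
    - intros s Hg HAs. now destruct (HA s Hg).
    - unfold mean. rewrite (sumR_ext_in _ (fun _ => 0)), sumR_const by (intros; ring). lra. }
  assert (H : infinite_sum (fun k => exp (- (INR (nparts N) * t)) * (INR (nparts N) * t) ^ k
     / INR (fact k) * prob_list (dist_k N k) A) 0).
  { intros eps He. exists 0%nat. intros n _.
    rewrite (sum_eq _ (fun _ => 0)), sum_cte, Rmult_0_l, Rdist_eq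
      by (intros; rewrite H0; ring). exact He. }
  apply (uniqueness_sum _ _ _ (epsilon_spec (inhabits 0) _ (ex_intro _ 0 H)) H).
Qed.

Theorem theorem1p4 :
  forall T : R, 0 < T ->
  exists c1 : R, 0 < c1 /\
  forall a : R, 0 <= a ->
    ((a <= 1 ->
      forall eps : R, 0 < eps -> exists N0 : nat, forall N : nat, (N0 <= N)%nat ->
        prob_at N (INR N ^ 2 * T) (fun s => a * INR N <= IZR (Z.abs (J s)))
        <= exp (INR N * (- c1 * a ^ 2 + eps)))
     /\
     (1 < a ->
      forall K : R, exists N0 : nat, forall N : nat, (N0 <= N)%nat ->
        prob_at N (INR N ^ 2 * T) (fun s => a * INR N <= IZR (Z.abs (J s)))
        <= exp (- K * INR N)))
    /\
    (forall eps : R, 0 < eps -> exists N0 : nat, forall N : nat, (N0 <= N)%nat ->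
        prob_at N (INR N ^ 2 * T) (fun s => a * INR N <= IZR (Z.abs (tagged N s)))
        <= exp (INR N * (- c1 * a ^ 2 + eps))).
Proof.
  intros T HT.
  set (B := 10 * T + 1). set (q := exp (- (20 * T))).
  assert (HB : 1 <= B) by (unfold B; lra).
  assert (Hq : 0 < q) by apply exp_pos.
  (* One rate for three regimes: the current, the tagged particle for [a < 96 B], and the tagged
     particle for [a >= 96 B]. *)
  set (c1 := Rmin (1/72) (Rmin (q ^ 2 / (288 * (96 * B) ^ 2)) (/ (32 * B)))).
  assert (Hc1 : c1 <= 1/72) by apply Rmin_l.
  assert (Hc2 : c1 <= q ^ 2 / (288 * (96 * B) ^ 2))
    by (eapply Rle_trans; [apply Rmin_r|apply Rmin_l]).
  assert (Hc3 : c1 <= / (32 * B)) by (eapply Rle_trans; [apply Rmin_r|apply Rmin_r]).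
  assert (Hc0 : 0 < c1).
  { unfold c1. repeat apply Rmin_glb_lt; [lra| |apply Rinv_0_lt_compat; lra].
    apply Rdiv_lt_0_compat; nra. }
  exists c1. split; [exact Hc0|]. intros a Ha.
  assert (Hpos : forall N, 0 <= INR N ^ 2 * T) by (intros; apply Rmult_le_pos; [apply pow2_ge_0|lra]).
  assert (Hca : forall N, INR N * (c1 * a ^ 2) = c1 * a ^ 2 * INR N) by (intros; ring).
  replace (- c1 * a ^ 2) with (- (c1 * a ^ 2)) by ring.
  assert (Ha2 : 0 <= a ^ 2) by apply pow2_ge_0.
  split; [split|].
  - intros Ha1 eps Heps.
    destruct (eventually_large T (c1 * a ^ 2) eps (/ a) HT Heps) as [N0 HN0].
    exists N0. intros N HN. destruct (HN0 N HN) as (HN1 & HL & He & Hx).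
    destruct Ha as [Ha|<-].
    + eapply combine_tails; [apply prob_at_le; auto| |exact HL|exact He].
      * apply Rmult_le_pos; [lra|left; apply exp_pos].
      * intros k _. apply J_tail; [auto|lra|].
        rewrite <- (Rinv_r a) by lra. apply Rmult_le_compat_l; lra.
      * rewrite Hca. apply Rmult_le_compat_r; [apply pos_INR|nra].
    (* For [a = 0] the condition [1 <= a N] fails, but the claimed rate is 0 and the trivial bound
       [1 <= 2 exp 1] suffices. *)
    + eapply (combine_tails _ _ _ _ 0); [apply prob_at_le; auto| |exact HL|exact He].
      * apply Rmult_le_pos; [lra|left; apply exp_pos].
      * intros k _. eapply Rle_trans; [apply prob_list_le1|].
        pose proof (exp_ineq1_le (1 - 0)). lra.
      * right. ring.
  (* From [N >= 2 / (a - 1)] follows [a N >= N + 2], above the largest possible current. *)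
  - intros Ha1 K. destruct (eventually_ge (2 / (a - 1))) as [N0 HN0].
    exists N0. intros N HN. specialize (HN0 N HN).
    rewrite prob_at_impossible; [left; apply exp_pos|].
    intros s Hg Hs. apply J_le in Hg.
    apply (Rmult_le_compat_l (a - 1)) in HN0; [|lra].
    replace ((a - 1) * (2 / (a - 1))) with 2 in HN0 by (field; lra). lra.
  - intros eps Heps.
    destruct (eventually_large T (c1 * a ^ 2) eps (2 * a) HT Heps) as [N0 HN0].
    exists N0. intros N HN. destruct (HN0 N HN) as (HN1 & HL & He & Hx).
    pose proof (pos_INR N) as HN0'.
    (* The exponent is written [1 - (1 + ...)] to fit [combine_tails]. *)
    assert (HT2 : forall k, INR k <= 4 * (INR (nparts N) * (INR N ^ 2 * T)) ->
      prob_list (dist_k N k) (fun s => a * INR N <= IZR (Z.abs (tagged N s)))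
      <= 2 * exp (1 - (1 + c1 * a ^ 2 * INR N))).
    { intros k Hk. replace (1 - (1 + c1 * a ^ 2 * INR N)) with (- (c1 * a ^ 2 * INR N)) by ring.
      destruct (Rle_lt_dec (96 * B) a) as [HaB|HaB].
      - eapply Rle_trans; [apply (tagged_tail_large N k a T); auto|].
        apply Rmult_le_compat_l; [lra|]. apply exp_le_compat, Ropp_le_contravar.
        apply Rmult_le_compat_r; [auto|]. now apply Rmult_le_compat_r.
      (* Replacing [a] by [a / (96 B) <= 1] enlarges the event and costs the factor [(96 B)^2] in
         the rate. *)
      - assert (HaB1 : a / (96 * B) <= 1).
        { apply Rmult_le_reg_r with (96 * B); [lra|]. field_simplify; lra. }
        assert (HaB0 : 0 <= a / (96 * B))
          by (apply Rmult_le_pos; [lra|left; apply Rinv_0_lt_compat; lra]).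
        apply Rle_trans with (prob_list (dist_k N k)
          (fun s => a / (96 * B) * INR N <= IZR (Z.abs (tagged N s)))).
        + apply prob_list_le. intros s _ Hs. eapply Rle_trans; [|exact Hs].
          apply Rmult_le_compat_r; [auto|].
          apply Rmult_le_reg_r with (96 * B); [lra|].
          replace (a / (96 * B) * (96 * B)) with a by (field; lra). nra.
        + eapply Rle_trans; [apply (tagged_tail_moderate N k _ T); auto|].
          apply Rmult_le_compat_l; [lra|]. apply exp_le_compat, Ropp_le_contravar.
          apply Rmult_le_compat_r; [auto|]. fold q.
          apply Rle_trans with (q ^ 2 / (288 * (96 * B) ^ 2) * a ^ 2);
            [now apply Rmult_le_compat_r|right; field; lra]. }
    eapply combine_tails; [apply prob_at_le; [auto| |exact HT2]| |exact HL|exact He].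
    + apply Rmult_le_pos; [lra|left; apply exp_pos].
    + rewrite Hca. lra.
Qed.
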